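(* Let $n\geq 2$ and let $\mu$ be an $\mathbb{F}_q$-labeled set partition of $\{1,2,\dots,n-1\}$. Then $$\mathrm{Ind}_{U_{n-1}}^{U_n}(\chi^\mu)=\chi^\mu *_1\chi^{\{n\}},$$ where $\chi^\mu$ is the supercharacter of $U_{n-1}$ indexed by $\mu$ and the right-hand side is a combination of supercharacters of $U_n$.
   Context: Groups. $U_n$ is the group of $n\times n$ unipotent upper-triangular matrices over the finite field $\mathbb{F}_q$, and $\mathfrak{n}_n=\{u-1\mid u\in U_n\}$. $U_{n-1}$ is embedded in $U_n$ as the matrices $u\in U_n$ with $u_{in}=0$ for all $i<n$. Labeled set partitions. An $\mathbb{F}_q$-labeled set partition of a finite set $S$ of integers is a set partition of $S$ in which, for each pair $i<j$ of consecutive elements of a part (an arc $i\frown j$), a label in $\mathbb{F}_q^\times$ is chosen. Write $\mu_{ij}$ for the label of the arc $i\frown j$ of $\mu$, and $\mu_{ij}=0$ if $i\frown j$ is not an arc. Thus $\mu$ is determined by its ground set and a strictly upper-triangular array $(\mu_{ij})$ with at most one nonzero entry in every row and every column. Supercharacters. Fix a nontrivial homomorphism $\theta:\mathbb{F}_q^+\to\mathbb{C}^\times$. $U_n$ acts on both sides of the dual space $\mathfrak{n}_n^*$ by $(u\lambda v)(x-1)=\lambda(u^{-1}(x-1)v^{-1})$ for $\lambda\in\mathfrak{n}_n^*$, $u,v,x\in U_n$. For $\lambda\in\mathfrak{n}_n^*$, $$\chi^\lambda(u)=\frac{|U_n\lambda|}{|U_n\lambda U_n|}\sum_{\nu\in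 U_n(-\lambda)U_n}\theta\big(\nu(u-1)\big),\qquad u\in U_n.$$ A labeled set partition $\lambda$ of $\{1,\dots,n\}$ is identified with the functional $\lambda\in\mathfrak{n}_n^*$ with $\lambda(e_{ij})=\lambda_{ij}$ for $i<j$, where $e_{ij}$ is the matrix unit. Supercharacters of $U_{n-1}$ are defined in the same way with $n-1$ in place of $n$. The product $*_i$. For a labeled set partition $\mu$ and $i,k\in\mathbb{Z}_{\geq1}$ with $i\le k$, $\mu *_i\{k\}$ is the formal linear combination of labeled set partitions defined recursively, using the first applicable case, by $$\mu *_i\{k\}=\begin{cases} \mu\cup\{k\}, & \text{if } i=k,\\ q\,(\mu *_{i+1}\{k\}), & \text{if there is } l>k\text{ with }\mu_{il}\neq 0,\\ \mu\big|_{i\frown k\,\mapsto\, i\mid k} *_{i+1}\{k\}, & \text{if }\mu_{ik}\neq 0,\\ \mu *_{i+1}\{k\}+\sum_{t\in\mathbb{F}_q^\times}\mu\big|_{i\frown j\,\mapsto\, i\overset{t}{\frown}k} *_{i+1}\{j\}, & \text{if there is } j<k\text{ with }\mu_{ij}\neq 0,\\ \mu *_{i+1}\{k\}+\sum_{t\in\mathbb{F}_q^\times}\mu\big|_{i\mid\,\mapsto\, i\overset{t}{\frown}k}, & \text{otherwise.} \end{cases}$$ Here $\mu|_{i\frown k\mapsto i\mid k}$ deletes the arc $i\frown k$; $\mu|_{i\frown j\mapsto i\overset{t}{\frown}k}$ deletes the arc $i\frown j$ and adds the arc $i\frown k$ with label $t$; $\mu|_{i\mid\mapsto i\overset{t}{\frown}k}$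 adds the arc $i\frown k$ with label $t$ (here $i$ is the last element of its part); all other arcs are unchanged. $\mu\cup\{k\}$ has the same arcs as $\mu$, with $k$ included in the ground set. In computing $\mu*_1\{n\}$ for $\mu$ a labeled set partition of $\{1,\dots,n-1\}$, all resulting labeled set partitions have ground set $\{1,\dots,n\}$. If $\mu *_i\{k\}=\sum_\lambda c_{\mu k}^\lambda\,\lambda$, then $\chi^\mu *_i\chi^{\{k\}}:=\sum_\lambda c_{\mu k}^\lambda\,\chi^\lambda$. *)

(* Defs.v *)
From HB Require Import structures.
From mathcomp Require Import all_boot all_order all_algebra all_fingroup.
From mathcomp Require Import all_solvable all_field all_character.

Set Implicit Arguments.
Unset Strict Implicit.
Unset Printing Implicit Defensive.

Import GRing.Theory.
Local Open Scope ring_scope.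

(* Rows, columns and elements of ground sets are numbered from 0: the element
   i of {1, .., n} is the ordinal with value i - 1 in 'I_n. *)

Definition strict_upper (F : finFieldType) n (x : 'M[F]_n) : bool :=
  [forall i : 'I_n, forall j : 'I_n, (j <= i)%N ==> (x i j == 0)].

Definition unitriangular (F : finFieldType) n (u : 'M[F]_n) : bool :=
  [forall i : 'I_n, forall j : 'I_n, (j <= i)%N ==> (u i j == (i == j)%:R)].

Lemma strict_upperP (F : finFieldType) n (x : 'M[F]_n) :
  reflect (forall i j : 'I_n, (j <= i)%N -> x i j = 0) (strict_upper x).
Proof.
apply: (iffP forallP) => [h i j ji | h i]; last first.
  by apply/forallP => j; apply/implyP => /h ->.
by move/(_ i)/forallP/(_ j)/implyP/(_ ji)/eqP: h.
Qed.

Lemma unitriangularP (F : finFieldType) n (u : 'M[F]_n) :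
  reflect (forall i j : 'I_n, (j <= i)%N -> u i j = (i == j)%:R)
          (unitriangular u).
Proof.
apply: (iffP forallP) => [h i j ji | h i]; last first.
  by apply/forallP => j; apply/implyP => /h ->.
by move/(_ i)/forallP/(_ j)/implyP/(_ ji)/eqP: h.
Qed.

Lemma unitriangularE (F : finFieldType) n (u : 'M[F]_n) :
  unitriangular u = strict_upper (u - 1%:M).
Proof.
apply/unitriangularP/strict_upperP => h i j /h; rewrite !mxE.
  by move=> ->; rewrite subrr.
by move/eqP; rewrite subr_eq0 => /eqP.
Qed.

Lemma strict_upper0 (F : finFieldType) n : strict_upper (0 : 'M[F]_n).
Proof. by apply/strict_upperP => i j _; rewrite mxE. Qed.

Lemma strict_upperZD (F : finFieldType) n (a : F) (x y : 'M[F]_n) :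
  strict_upper x -> strict_upper y -> strict_upper (a *: x + y).
Proof.
move=> /strict_upperP hx /strict_upperP hy; apply/strict_upperP => i j ij.
by rewrite !mxE hx // hy // mulr0 addr0.
Qed.

Lemma strict_upper_mull (F : finFieldType) n (u x : 'M[F]_n) :
  unitriangular u -> strict_upper x -> strict_upper (u *m x).
Proof.
move=> /unitriangularP hu /strict_upperP hx; apply/strict_upperP => i j ji.
rewrite mxE big1 // => k _; have [jk | kj] := leqP j k.
  by rewrite hx // mulr0.
rewrite hu; last exact: leq_trans (ltnW kj) ji.
by rewrite -val_eqE gtn_eqF ?mul0r // (leq_trans kj).
Qed.

Lemma strict_upper_mulr (F : finFieldType) n (u x : 'M[F]_n) :
  unitriangular u -> strict_upper x -> strict_upper (x *m u).
Proof.
move=> /unitriangularP hu /strict_upperP hx; apply/strict_upperP => i j ji.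
rewrite mxE big1 // => k _; have [ki | ik] := leqP k i.
  by rewrite hx // mul0r.
rewrite hu; last exact: leq_trans ji (ltnW ik).
by rewrite -val_eqE gtn_eqF ?mulr0 // (leq_ltn_trans ji).
Qed.

Lemma unitriangular1 (F : finFieldType) n : unitriangular (1%:M : 'M[F]_n).
Proof. by rewrite unitriangularE subrr strict_upper0. Qed.

Lemma unitriangularM (F : finFieldType) n (u v : 'M[F]_n) :
  unitriangular u -> unitriangular v -> unitriangular (u *m v).
Proof.
move=> hu hv; rewrite unitriangularE.
have -> : u *m v - 1%:M = 1 *: (u *m (v - 1%:M)) + (u - 1%:M).
  by rewrite scale1r mulmxBr mulmx1 addrA subrK.
by rewrite strict_upperZD // -?unitriangularE // strict_upper_mull //
  -unitriangularE.
Qed.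

Lemma unitriangular_unit (F : finFieldType) n (u : 'M[F]_n) :
  unitriangular u -> u \in unitmx.
Proof.
move=> /unitriangularP hu; rewrite -unitmx_tr unitmxE det_trig.
  by rewrite big1 ?unitr1 // => i _; rewrite mxE hu // eqxx.
apply/is_trig_mxP => i j ij; rewrite mxE hu 1?ltnW //.
by rewrite -val_eqE gtn_eqF.
Qed.

Record unip (F : finFieldType) n :=
  Unip {umx :> 'M[F]_n; _ : unitriangular umx}.
HB.instance Definition _ (F : finFieldType) n := [isSub for @umx F n].
HB.instance Definition _ (F : finFieldType) n := [Finite of unip F n by <:].

Lemma umxP (F : finFieldType) n (u : unip F n) : unitriangular u.
Proof. exact: valP. Qed.

Lemma unitriangularV (F : finFieldType) n (u : 'M[F]_n) :
  unitriangular u -> unitriangular (invmx u).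
Proof.
move=> hu; have uU := unitriangular_unit hu.
pose f (v : unip F n) := Unip (unitriangularM hu (umxP v)).
have f_inj : injective f.
  move=> v w /(congr1 val) /= e; apply: val_inj => /=.
  by rewrite -[umx v](mulKmx uU) e mulKmx.
have [g _ fK] := injF_bij f_inj.
have /(congr1 val)/= e := fK (Unip (unitriangular1 F n)).
suff -> : invmx u = g (Unip (unitriangular1 F n)) by exact: umxP.
by apply: (can_inj (mulKmx uU)); rewrite e mulmxV.
Qed.

Definition unip1 (F : finFieldType) n := Unip (unitriangular1 F n).
Definition unipM (F : finFieldType) n (u v : unip F n) :=
  Unip (unitriangularM (umxP u) (umxP v)).
Definition unipV (F : finFieldType) n (u : unip F n) :=
  Unip (unitriangularV (umxP u)).

Fact unipMA (F : finFieldType) n : associative (@unipM F n).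
Proof. by move=> u v w; apply: val_inj; rewrite /= mulmxA. Qed.
Fact unipM1 (F : finFieldType) n : left_id (@unip1 F n) (@unipM F n).
Proof. by move=> u; apply: val_inj; rewrite /= mul1mx. Qed.
Fact unipMV (F : finFieldType) n :
  left_inverse (@unip1 F n) (@unipV F n) (@unipM F n).
Proof.
by move=> u; apply: val_inj; rewrite /= mulVmx // unitriangular_unit ?umxP.
Qed.

HB.instance Definition _ (F : finFieldType) n :=
  Finite_isGroup.Build (unip F n) (@unipMA F n) (@unipM1 F n) (@unipMV F n).

Notation "''U_' n ( F )" := [set: unip F n]
  (at level 8, n at level 2, format "''U_' n ( F )").

(* U_n is embedded in U_(n+1) as the matrices whose last column is that of the
   identity. *)

Definition extmx (F : finFieldType) n (a : F) (x : 'M[F]_n) : 'M[F]_n.+1 :=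
  castmx (addn1 n, addn1 n) (block_mx x 0 0 a%:M).

Lemma extmxE (F : finFieldType) n (a : F) (x : 'M[F]_n) (i j : 'I_n.+1) :
  extmx a x i j =
    match unlift ord_max i, unlift ord_max j with
    | Some i', Some j' => x i' j'
    | None, None => a
    | _, _ => 0
    end.
Proof.
have cl (k : 'I_n) : cast_ord (esym (addn1 n)) (lift ord_max k) = lshift 1 k.
  by apply: val_inj; rewrite [val _]lift_max.
have cr : cast_ord (esym (addn1 n)) ord_max = rshift n (ord0 : 'I_1).
  by apply: val_inj; rewrite /= addn0.
rewrite castmxE /=.
case: unliftP => [i' -> | ->]; case: unliftP => [j' -> | ->]; rewrite ?cl ?cr.
- by rewrite block_mxEul.
- by rewrite block_mxEur mxE.
- by rewrite block_mxEdl mxE.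
- by rewrite block_mxEdr mxE eqxx.
Qed.

Lemma extmx_unitriangular (F : finFieldType) n (u : 'M[F]_n) :
  unitriangular u -> unitriangular (extmx 1 u).
Proof.
move=> /unitriangularP hu; apply/unitriangularP => i j; rewrite extmxE.
case: unliftP => [i' -> | ->]; case: unliftP => [j' -> | ->].
- by rewrite (inj_eq lift_inj) !lift_max /= => /hu.
- by rewrite lift_max /= leqNgt ltn_ord.
- by rewrite (negPf (neq_lift _ _)).
- by rewrite eqxx.
Qed.

Definition unip_ext (F : finFieldType) n (u : unip F n) : unip F n.+1 :=
  Unip (extmx_unitriangular (umxP u)).

Lemma unip_extM (F : finFieldType) n :
  {morph @unip_ext F n : u v / (u * v)%g}.
Proof.
move=> u v; apply: val_inj; rewrite /= /extmx.
case: _ / (addn1 n); rewrite !castmx_id mulmx_block.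
by rewrite !mulmx0 !mul0mx mul1mx !addr0 add0r.
Qed.

Canonical unip_ext_morphism (F : finFieldType) n :=
  @Morphism _ _ 'U_n(F) (@unip_ext F n) (in2W (@unip_extM F n)).

Definition usub (F : finFieldType) n : {set unip F n.+1} :=
  [set u : unip F n.+1 |
    [forall i : 'I_n.+1, (i < n)%N ==> (u i ord_max == 0)]].

Lemma unip_ext_inj (F : finFieldType) n : injective (@unip_ext F n).
Proof.
move=> u v /(congr1 val) /= e; apply: val_inj; apply/matrixP => i j /=.
move/matrixP/(_ (lift ord_max i) (lift ord_max j)): e.
by rewrite !extmxE !liftK.
Qed.

Lemma morphim_unip_ext (F : finFieldType) n :
  (@unip_ext F n @* 'U_n(F))%g = usub F n.
Proof.
apply/setP => u; apply/morphimP/idP => [[v _ _ ->] | ].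
  rewrite inE; apply/forallP => i; apply/implyP => lt_in.
  rewrite /= extmxE unlift_none; case: unliftP => // ei.
  by move: lt_in; rewrite ei ltnn.
rewrite inE => /forallP hu.
have hw : unitriangular (\matrix_(i, j) u (lift ord_max i) (lift ord_max j)).
  apply/unitriangularP => i j ji; rewrite mxE.
  rewrite (unitriangularP _ (umxP u)) ?(inj_eq lift_inj) //.
  by rewrite !lift_max.
exists (Unip hw); rewrite ?inE //; apply: val_inj; apply/matrixP => i j /=.
rewrite extmxE; case: unliftP => [i' -> | ->]; case: unliftP => [j' -> | ->].
- by rewrite mxE.
- apply/eqP; have := hu (lift ord_max i').
  by rewrite lift_max /= ltn_ord.
- rewrite (unitriangularP _ (umxP u)) ?(negPf (neq_lift _ _)) //.
  by rewrite lift_max /= ltnW.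
- by rewrite (unitriangularP _ (umxP u)) ?eqxx.
Qed.

Fact usub_group_set (F : finFieldType) n : group_set (usub F n).
Proof. by rewrite -morphim_unip_ext groupP. Qed.
Canonical usub_group (F : finFieldType) n := Group (usub_group_set F n).

Lemma unip_ext_isom (F : finFieldType) n :
  isom 'U_n(F) (usub F n) (@unip_ext F n).
Proof.
apply/isomP; split; last exact: morphim_unip_ext.
by apply/injmP => u v _ _; apply: unip_ext_inj.
Qed.

(* The space n_n = {u - 1 | u \in U_n}. *)

Record nilp (F : finFieldType) n :=
  Nilp {nmx :> 'M[F]_n; _ : nmx \in @strict_upper F n}.
HB.instance Definition _ (F : finFieldType) n := [isSub for @nmx F n].
HB.instance Definition _ (F : finFieldType) n := [Finite of nilp F n by <:].

Fact strict_upper_submod (F : finFieldType) n :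
  submod_closed (@strict_upper F n).
Proof.
by split=> [|a x y]; [apply: strict_upper0 | apply: strict_upperZD].
Qed.
HB.instance Definition _ (F : finFieldType) n :=
  GRing.isSubmodClosed.Build F 'M[F]_n (@strict_upper F n)
    (@strict_upper_submod F n).
HB.instance Definition _ (F : finFieldType) n :=
  [SubChoice_isSubLmodule of nilp F n by <:].

Lemma nmxP (F : finFieldType) n (x : nilp F n) : strict_upper x.
Proof. exact: valP. Qed.

Fact sub1_subproof (F : finFieldType) n (u : unip F n) :
  (umx u - 1%:M) \in @strict_upper F n.
Proof. by have := umxP u; rewrite unitriangularE. Qed.
Definition sub1 (F : finFieldType) n (u : unip F n) : nilp F n :=
  Nilp (sub1_subproof u).

Fact nilp_lr_subproof (F : finFieldType) n (u : unip F n) (x : nilp F n)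
    (v : unip F n) : (u *m x *m v) \in @strict_upper F n.
Proof.
exact: strict_upper_mulr (umxP v) (strict_upper_mull (umxP u) (nmxP x)).
Qed.
Definition nilp_lr (F : finFieldType) n (u : unip F n) (x : nilp F n)
    (v : unip F n) : nilp F n := Nilp (nilp_lr_subproof u x v).

(* The dual of n_n consists of the finite functions on n_n that are linear, so
   that it is a finite type and orbits are finite sets. *)

Definition linear_ffun (F : finFieldType) n : {pred {ffun nilp F n -> F}} :=
  [pred l : {ffun nilp F n -> F} |
    [forall a : F, forall x, forall y, l (a *: x + y) == a * l x + l y]].

Lemma linear_ffunP (F : finFieldType) n (l : {ffun nilp F n -> F}) :
  reflect (forall a x y, l (a *: x + y) = a * l x + l y)
          (l \in @linear_ffun F n).
Proof.
apply: (iffP forallP) => [h a x y | h a].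
  by apply/eqP; have /forallP/(_ x)/forallP := h a; apply.
by apply/forallP => x; apply/forallP => y; rewrite h.
Qed.

Fact linear_ffun_zmod (F : finFieldType) n : zmod_closed (@linear_ffun F n).
Proof.
split=> [|l m /linear_ffunP hl /linear_ffunP hm]; apply/linear_ffunP.
  by move=> a x y; rewrite !ffunE mulr0 addr0.
by move=> a x y; rewrite !ffunE hl hm mulrBr opprD addrACA.
Qed.
HB.instance Definition _ (F : finFieldType) n :=
  GRing.isZmodClosed.Build {ffun nilp F n -> F} (@linear_ffun F n)
    (@linear_ffun_zmod F n).

Record dual (F : finFieldType) n :=
  Dual {dfun : {ffun nilp F n -> F}; _ : dfun \in @linear_ffun F n}.
HB.instance Definition _ (F : finFieldType) n := [isSub for @dfun F n].
HB.instance Definition _ (F : finFieldType) n := [Finite of dual F n by <:].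
HB.instance Definition _ (F : finFieldType) n :=
  [SubChoice_isSubZmodule of dual F n by <:].

Definition dual_apply (F : finFieldType) n (l : dual F n) : nilp F n -> F :=
  dfun l.
Coercion dual_apply : dual >-> Funclass.

Lemma dual_linear (F : finFieldType) n (l : dual F n) a x y :
  l (a *: x + y) = a * l x + l y.
Proof. by move: a x y; apply/linear_ffunP/valP. Qed.

Fact dual_act_subproof (F : finFieldType) n (u : unip F n) (l : dual F n)
    (v : unip F n) :
  [ffun x => l (nilp_lr u^-1%g x v^-1%g)] \in @linear_ffun F n.
Proof.
apply/linear_ffunP => a x y; rewrite !ffunE -dual_linear; congr (l _).
apply: val_inj => /=.
by rewrite mulmxDr -scalemxAr mulmxDl -scalemxAl.
Qed.
Definition dual_act (F : finFieldType) n (u : unip F n) (l : dual F n)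
    (v : unip F n) : dual F n := Dual (dual_act_subproof u l v).

Lemma dual_actE (F : finFieldType) n (u : unip F n) (l : dual F n)
    (v : unip F n) x :
  dual_act u l v x = l (nilp_lr u^-1%g x v^-1%g).
Proof. by rewrite /dual_apply ffunE. Qed.

Definition left_orbit (F : finFieldType) n (l : dual F n) : {set dual F n} :=
  [set dual_act u l 1%g | u : unip F n].

Definition two_sided_orbit (F : finFieldType) n (l : dual F n) :
    {set dual F n} :=
  [set dual_act u l v | u : unip F n, v : unip F n].

Lemma dual_actM (F : finFieldType) n (u u' v v' : unip F n) (l : dual F n) :
  dual_act u (dual_act u' l v') v = dual_act (u * u')%g l (v' * v)%g.
Proof.
apply: val_inj; apply/ffunP => x; rewrite !ffunE dual_actE; congr (l _).
by apply: val_inj; rewrite !invMg /= !mulmxA.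
Qed.

Lemma dual_act1 (F : finFieldType) n (l : dual F n) :
  dual_act 1%g l 1%g = l.
Proof.
apply: val_inj; apply/ffunP => x; rewrite !ffunE invg1; congr (l _).
by apply: val_inj; rewrite /= mul1mx mulmx1.
Qed.

Fact superchar_subproof (F : finFieldType) (theta : F -> algC) n
    (l : dual F n) :
  is_class_fun <<'U_n(F)>>%g
    [ffun u => #|left_orbit l|%:R / #|two_sided_orbit l|%:R
                 * \sum_(nu in two_sided_orbit (- l)) theta (nu (sub1 u))].
Proof.
rewrite genGid; apply: intro_class_fun => [u v _ _ | u]; last by rewrite inE.
congr (_ * _).
have act_bij : {on two_sided_orbit (- l),
    bijective (fun nu : dual F n => dual_act v^-1%g nu v)}.
  apply: onW_bij.
  by exists (fun nu => dual_act v nu v^-1%g) => nu;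
    rewrite dual_actM ?mulVg ?mulgV dual_act1.
rewrite (reindex _ act_bij) /=; apply: eq_big => [nu | nu _]; last first.
  rewrite dual_actE invgK; congr (theta (nu _)); apply: val_inj => /=.
  rewrite mulmxBr mulmx1 mulmxBl; congr (_ - _).
    rewrite !mulmxA mulmxV ?unitriangular_unit ?umxP // mul1mx.
    by rewrite mulmxK ?unitriangular_unit ?umxP.
  by rewrite mulmxV ?unitriangular_unit ?umxP.
apply/imset2P/imset2P => [[a b _ _ e] | [a b _ _ ->]]; last first.
  by exists (v^-1 * a)%g (b * v)%g; rewrite ?dual_actM.
exists (v * a)%g (b * v^-1)%g; rewrite // -dual_actM -e dual_actM.
by rewrite mulgV dual_act1.
Qed.

Definition superchar (F : finFieldType) (theta : F -> algC) n (l : dual F n) :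
    'CF('U_n(F)) := Cfun 0 (superchar_subproof theta l).

Definition nontrivial_addchar (F : finFieldType) (theta : F -> algC) : Prop :=
  [/\ forall x, theta x != 0,
      forall x y, theta (x + y) = theta x * theta y
    & exists x, theta x != 1].

(* A labeled set partition of {1, .., n} is given by its array of arc labels. *)

Definition is_lsp (F : finFieldType) n (mu : 'M[F]_n) : bool :=
  [&& strict_upper mu,
      [forall i, (#|[set j | mu i j != 0%R]| <= 1)%N]
    & [forall j, (#|[set i | mu i j != 0%R]| <= 1)%N]].

Record lsp (F : finFieldType) n :=
  Lsp {labels :> 'M[F]_n; _ : is_lsp labels}.
HB.instance Definition _ (F : finFieldType) n := [isSub for @labels F n].
HB.instance Definition _ (F : finFieldType) n := [Finite of lsp F n by <:].

Fact functional_subproof (F : finFieldType) n (mu : 'M[F]_n) :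
  [ffun x : nilp F n => \sum_i \sum_j mu i j * x i j] \in @linear_ffun F n.
Proof.
apply/linear_ffunP => a x y; rewrite !ffunE mulr_sumr -big_split.
apply: eq_bigr => i _; rewrite mulr_sumr -big_split; apply: eq_bigr => j _.
by rewrite /= !mxE mulrDr mulrCA.
Qed.
Definition functional (F : finFieldType) n (mu : 'M[F]_n) : dual F n :=
  Dual (functional_subproof mu).

Fact nilp_delta_subproof (F : finFieldType) n (i j : 'I_n) :
  (i < j)%N -> delta_mx i j \in @strict_upper F n.
Proof.
move=> ij; apply/strict_upperP => a b ba; rewrite mxE.
case: eqP => //= ai; case: eqP => // bj.
by move: ba; rewrite ai bj leqNgt ij.
Qed.

Lemma functional_delta (F : finFieldType) n (mu : 'M[F]_n) (i j : 'I_n)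
    (ij : (i < j)%N) :
  functional mu (Nilp (nilp_delta_subproof F ij)) = mu i j.
Proof.
rewrite /dual_apply ffunE (bigD1 i) //= (bigD1 j) //= mxE !eqxx mulr1.
rewrite !big1 ?addr0 // => [a ai | b bj].
  by rewrite big1 // => b _; rewrite mxE (negPf ai) mulr0.
by rewrite mxE (negPf bj) andbF mulr0.
Qed.

(* Formal linear combinations of arrays of arc labels.  An array is changed
   one arc at a time; the label 0 deletes the arc.  In mu *_i {k} the ground
   set of mu already contains k, so that mu with k adjoined is mu. *)

Definition formal (F : finFieldType) n := {ffun 'M[F]_n -> algC}.

Definition single (F : finFieldType) n (mu : 'M[F]_n) : formal F n :=
  [ffun nu => (nu == mu)%:R].

Definition set_arc (F : finFieldType) n (mu : 'M[F]_n) (i j : 'I_n) (t : F) :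
    'M[F]_n :=
  \matrix_(a, b) if (a == i) && (b == j) then t else mu a b.

(* One unfolding of the recursion for mu *_i {k}, where rec stands for the
   product *_(i+1). *)
Definition star_step (F : finFieldType) n
    (rec : 'M[F]_n -> 'I_n -> 'I_n -> formal F n)
    (mu : 'M[F]_n) (i k : 'I_n) : formal F n :=
  if i == k then single mu
  else if [exists l : 'I_n, (k < l)%N && (mu i l != 0)] then
    rec mu (ordS i) k *+ #|F|
  else if mu i k != 0 then rec (set_arc mu i k 0) (ordS i) k
  else if [pick j : 'I_n | (j < k)%N && (mu i j != 0)] is Some j then
    rec mu (ordS i) k
      + \sum_(t : F | t != 0)
          rec (set_arc (set_arc mu i j 0) i k t) (ordS i) j
  else
    rec mu (ordS i) k + \sum_(t : F | t != 0) single (set_arc mu i k t).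

(* Since i increases and k does not, n unfoldings suffice; see starE. *)
Definition star (F : finFieldType) n :
    'M[F]_n -> 'I_n -> 'I_n -> formal F n :=
  iter n (@star_step F n) (fun _ _ _ => 0).

Lemma strict_upper_set_arc (F : finFieldType) n (mu : 'M[F]_n) (i j : 'I_n) t :
  (i < j)%N -> strict_upper mu -> strict_upper (set_arc mu i j t).
Proof.
move=> ij /strict_upperP h; apply/strict_upperP => a b ba; rewrite mxE.
case: ifP => [/andP[/eqP ea /eqP eb] | _]; last exact: h.
by move: ba; rewrite ea eb leqNgt ij.
Qed.

Lemma star_step_ext (F : finFieldType) n
    (rec1 rec2 : 'M[F]_n -> 'I_n -> 'I_n -> formal F n) mu (i k : 'I_n) :
    strict_upper mu -> (i <= k)%N ->
    (forall nu (j l : 'I_n), strict_upper nu ->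
       (j = i.+1 :> nat) -> (j <= l <= k)%N -> rec1 nu j l = rec2 nu j l) ->
  star_step rec1 mu i k = star_step rec2 mu i k.
Proof.
move=> su ik h; rewrite /star_step; have [//|neq] := eqVneq.
have lt_ik : (i < k)%N by rewrite ltn_neqAle ik (inj_eq (@ord_inj n)) neq.
have eS : ordS i = i.+1 :> nat.
  by rewrite /= modn_small // (leq_ltn_trans lt_ik).
have hk nu : strict_upper nu -> rec1 nu (ordS i) k = rec2 nu (ordS i) k.
  by move=> ?; apply: h => //; rewrite eS lt_ik leqnn.
rewrite !hk ?strict_upper_set_arc //; case: pickP => // j /andP[jk mj].
have ij : (i < j)%N.
  rewrite ltnNge; apply: contra mj => ji.
  by rewrite (strict_upperP _ su).
do 2![case: ifP => // _]; congr (_ + _); apply: eq_bigr => t _.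
by apply: h; rewrite ?strict_upper_set_arc // eS ij ltnW.
Qed.

Lemma starE (F : finFieldType) n (mu : 'M[F]_n) (i k : 'I_n) :
  strict_upper mu -> (i <= k)%N -> star mu i k = star_step (@star F n) mu i k.
Proof.
suff ind m1 m2 nu (j l : 'I_n) : strict_upper nu -> (j <= l)%N ->
    (l - j < m1)%N -> (l - j < m2)%N ->
    iter m1 (@star_step F n) (fun _ _ _ => 0) nu j l
    = iter m2 (@star_step F n) (fun _ _ _ => 0) nu j l.
  move=> su ik; rewrite /star -iterS; apply: ind => //.
    by rewrite (leq_ltn_trans (leq_subr _ _)).
  by rewrite ltnS (leq_trans (leq_subr _ _)) // ltnW.
elim: m1 m2 nu j l => [|m1 IH] [|m2] // nu j l su jl h1 h2; rewrite !iterS.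
apply: star_step_ext => // nu' j' l' su' ej /andP[j'l' l'l].
have lt : (l' - j' < l - j)%N.
  by rewrite ej; apply: leq_trans (leq_sub2r j l'l); rewrite subnS prednK
    ?subn_gt0 // -ej.
by apply: IH; rewrite // (leq_trans lt).
Qed.

(* A labeled set partition in which k is not the right end of an arc only
   contributes labeled set partitions to mu *_i {k}. *)

Lemma is_lspP (F : finFieldType) n (mu : 'M[F]_n) :
  reflect [/\ strict_upper mu,
              forall i j j', mu i j != 0 -> mu i j' != 0 -> j = j'
            & forall i i' j, mu i j != 0 -> mu i' j != 0 -> i = i']
          (is_lsp mu).
Proof.
apply: (iffP and3P) => -[su hr hc]; split=> //.
- move=> i j j' hj hj'; have /card_le1_eqP := forallP hr i.
  by apply; rewrite inE.
- move=> i i' j hi hi'; have /card_le1_eqP := forallP hc j.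
  by apply; rewrite inE.
- apply/forallP => i; apply/card_le1_eqP => j j'.
  by rewrite !inE => h h'; rewrite (hr _ _ _ h h').
- apply/forallP => j; apply/card_le1_eqP => i i'.
  by rewrite !inE => h h'; rewrite (hc _ _ _ h h').
Qed.

Lemma is_lsp_del (F : finFieldType) n (mu : 'M[F]_n) (i j : 'I_n) :
  is_lsp mu -> is_lsp (set_arc mu i j 0).
Proof.
move=> /is_lspP[/strict_upperP su hr hc].
have sub a b : set_arc mu i j 0 a b != 0 -> mu a b != 0.
  by rewrite mxE; case: ifP => // _; rewrite eqxx.
apply/is_lspP; split.
- apply/strict_upperP => a b ba; apply/eqP/negPn/negP => /sub.
  by rewrite su ?eqxx.
- by move=> a b b' /sub h /sub; apply: hr.
- by move=> a a' b /sub h /sub; apply: hc.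
Qed.

Lemma is_lsp_add (F : finFieldType) n (mu : 'M[F]_n) (i k : 'I_n) t :
    is_lsp mu -> (i < k)%N ->
    (forall j, mu i j = 0) -> (forall a, mu a k = 0) ->
  is_lsp (set_arc mu i k t).
Proof.
move=> /is_lspP[su hr hc] ik ri ck.
have sub a b : set_arc mu i k t a b != 0 ->
    (a == i) && (b == k) \/ [/\ a != i, b != k & mu a b != 0].
  rewrite mxE; case: ifP => [_ _ | _ h]; [by left | right; split=> //].
    by apply: contraNneq h => ->; rewrite ri.
  by apply: contraNneq h => ->; rewrite ck.
apply/is_lspP; split; first exact: strict_upper_set_arc.
- move=> a b b' /sub[/andP[/eqP-> /eqP->] | [ai bk h]];
    move=> /sub[/andP[/eqP ea /eqP->] | [ai' bk' h']] //.
  + by rewrite eqxx in ai'.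
  + by rewrite ea eqxx in ai.
  + exact: hr h h'.
- move=> a a' b /sub[/andP[/eqP-> /eqP->] | [ai bk h]];
    move=> /sub[/andP[/eqP-> /eqP eb] | [ai' bk' h']] //.
  + by rewrite eqxx in bk'.
  + by rewrite eb eqxx in bk.
  + exact: hc h h'.
Qed.

Lemma star_lsp (F : finFieldType) n (mu : 'M[F]_n) (i k : 'I_n) (nu : 'M[F]_n) :
    is_lsp mu -> (i <= k)%N -> (forall a, mu a k = 0) ->
  star mu i k nu != 0 -> is_lsp nu.
Proof.
suff ind m : forall (mu : 'M[F]_n) (i k : 'I_n),
    is_lsp mu -> (i <= k)%N -> (forall a, mu a k = 0) ->
    iter m (@star_step F n) (fun _ _ _ => 0) mu i k nu != 0 -> is_lsp nu.
  exact: ind.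
elim: m => [|m IH] {}mu {}i {}k lmu ik ck.
  by rewrite /= ffunE eqxx.
have D (f g : formal F n) : (f nu != 0 -> is_lsp nu) ->
    (g nu != 0 -> is_lsp nu) -> (f + g) nu != 0 -> is_lsp nu.
  move=> hf hg; rewrite ffunE.
  by have [-> | /hf] := eqVneq (f nu) 0; rewrite ?add0r.
have S (f : F -> formal F n) :
    (forall t, t != 0 -> f t nu != 0 -> is_lsp nu) ->
    (\sum_(t | t != 0) f t) nu != 0 -> is_lsp nu.
  by move=> hf; apply: (big_ind (fun f : formal F n => f nu != 0 -> is_lsp nu))
    => [|f1 f2|]; [rewrite ffunE eqxx | apply: D | apply: hf].
have single_lsp la : is_lsp la -> single la nu != 0 -> is_lsp nu.
  by rewrite ffunE; case: (eqVneq nu la) => [-> | _]; rewrite ?eqxx.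
rewrite iterS {1}/star_step.
have [_|neq] := eqVneq i k; first exact: single_lsp.
have lt_ik : (i < k)%N by rewrite ltn_neqAle ik (inj_eq (@ord_inj n)) neq.
have eS : ordS i = i.+1 :> nat.
  by rewrite /= modn_small // (leq_ltn_trans lt_ik).
have Sik : (ordS i <= k)%N by rewrite eS.
case: ifP => [_ | /existsPn hl].
  rewrite ffunMnE => h; apply: (IH mu (ordS i) k) => //.
  by apply: contraNneq h => ->; rewrite mul0rn.
rewrite ck eqxx /=; case/is_lspP: (lmu) => su hr hc.
case: pickP => [j /andP[jk mj] | hj]; apply: D; try exact: IH.
  apply: S => t _; apply: IH.
  - apply: is_lsp_add => //; first exact: is_lsp_del.
      move=> b; rewrite mxE eqxx /=; case: eqP => // bj.
      by apply/eqP/negPn/negP => /hr/(_ mj).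
    by move=> a; rewrite mxE ck if_same.
  - rewrite eS ltnNge; apply: contra mj => ji.
    by rewrite (strict_upperP _ su).
  - move=> a; rewrite !mxE (_ : j == k = false) ?andbF; last first.
      by rewrite -val_eqE ltn_eqF.
    rewrite eqxx andbT; case: eqP => // ai.
    by apply/eqP/negPn/negP => /hc/(_ mj).
apply: S => t _; apply: single_lsp; apply: is_lsp_add => // b.
case: (ltngtP b k) => [bk | kb | /val_inj -> //].
  by have := hj b; rewrite bk /= => /negPn/eqP.
by have := hl b; rewrite kb /= => /negPn/eqP.
Qed.

Lemma extmx_lsp (F : finFieldType) n (mu : lsp F n) :
  is_lsp (extmx 0 mu) /\ (forall a, extmx 0 mu a ord_max = 0).
Proof.
have /is_lspP[su hr hc] : is_lsp mu by exact: valP.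
split; last by move=> a; rewrite extmxE unlift_none; case: unliftP.
have E a b : extmx 0 mu a b != 0 -> exists a', exists b',
    [/\ a = lift ord_max a', b = lift ord_max b' & mu a' b' != 0].
  rewrite extmxE; case: unliftP => [a' -> | _]; case: unliftP => [b' -> | _];
    rewrite ?eqxx // => h.
  by exists a', b'.
apply/is_lspP; split.
- apply/strict_upperP => a b ba; apply/eqP/negPn/negP.
  move=> /E[a' [b' [ea eb]]]; rewrite (strict_upperP _ su) ?eqxx //.
  by move: ba; rewrite ea eb !lift_max.
- move=> a b b' /E[c [d [-> -> h]]] /E[c' [d' [/lift_inj cc' -> h']]].
  by rewrite -cc' in h'; rewrite (hr _ _ _ h h').
- move=> a a' b /E[c [d [-> -> h]]] /E[c' [d' [-> /lift_inj dd' h']]].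
  by rewrite -dd' in h'; rewrite (hc _ _ _ h h').
Qed.

(* Main.v *)
Require Import Defs.
From mathcomp Require Import all_boot all_order all_algebra all_fingroup.
From mathcomp Require Import all_solvable all_field all_character.

(* Averaging over U_n on both sides shows that the supercharacter of a labeled
   set partition factors as the product over its arcs of the supercharacters of
   single arcs: the rows of the left factor are independent, and the average
   over the right factor is a Fourier inversion.  Let P(i, k) be the sum of the
   trivial character and of all arc characters j -- k with i <= j < k.  Writing
   f(i, j, t) for the character of the arc i -- j with label t, one has
   f(i, l, t) f(i, j, s) = f(i, l, t) P(i+1, j) for i < j < l and s, t <> 0,
   whence, by induction along the recursion, chi^mu *_i chi^{k} is the pointwise
   product chi^mu P(i, k).
   Finally chi^mu is the restriction to U_(n-1) of the supercharacter of U_n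
   attached to the same arcs, so its induction is the product of the latter with
   the permutation character of U_n on U_n / U_(n-1), which Fourier inversion
   identifies with P(1, n). *)

Set Implicit Arguments.
Unset Strict Implicit.
Unset Printing Implicit Defensive.

Import GRing.Theory Num.Theory.
Local Open Scope ring_scope.

(** * Sums of additive characters *)

Section AdditiveCharacter.

Variables (F : finFieldType) (theta : F -> algC).
Hypothesis theta_char : nontrivial_addchar theta.

Lemma addcharD a b : theta (a + b) = theta a * theta b.
Proof. by case: theta_char. Qed.

Lemma addchar0 : theta 0 = 1.
Proof.
case: theta_char => nz hD _; apply: (mulfI (nz 0)).
by rewrite -hD addr0 mulr1.
Qed.

Lemma addchar_sum (I : Type) (r : seq I) (P : pred I) (f : I -> F) :
  theta (\sum_(i <- r | P i) f i) = \prod_(i <- r | P i) theta (f i).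
Proof. exact: (big_morph theta addcharD addchar0). Qed.

(** If [a] were nonzero, its multiples would fill [F], where [theta] is not constantly 1. *)
Lemma addchar_scale_trivial (a : F) :
  (forall t, theta (t * a) = 1) -> a = 0.
Proof.
move=> h; apply/eqP/negPn/negP => nz; case: theta_char => _ _ [b].
by rewrite -[b](divfK nz) h eqxx.
Qed.

(** Translation by some [w] in [S] with [psi w != 1] preserves [S] and multiplies the sum by
    [psi w], so the sum vanishes. *)
Lemma sum_character (V : finZmodType) (S : pred V) (psi : V -> algC) :
    (forall v w, S v -> S (v + w) = S w) ->
    (forall v w, psi (v + w) = psi v * psi w) ->
  \sum_(v | S v) psi v =
    if [forall v, S v ==> (psi v == 1)] then #|S|%:R else 0.
Proof.
move=> hS hD; case: ifP => [/forallP h | /negbT/forallPn[w]].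
  rewrite (eq_bigr (fun=> 1)) ?sumr_const // => v Sv.
  by have := h v; rewrite Sv => /eqP.
rewrite negb_imply => /andP[Sw nz]; apply/eqP.
have e : \sum_(v | S v) psi v = psi w * \sum_(v | S v) psi v.
  rewrite {1}(reindex_inj (addrI w)) mulr_sumr.
  by apply: eq_big => [v | v _]; rewrite ?hS ?hD.
by move/eqP: e; rewrite -subr_eq0 -{1}[X in X - _]mul1r -mulrBl mulf_eq0
  subr_eq0 eq_sym (negPf nz).
Qed.

End AdditiveCharacter.

(** * Arc characters as weighted sums over row vectors *)

Section ArcCharacters.

Variables (F : finFieldType) (theta : F -> algC) (m : nat).
Variable x : 'M[F]_m.

(** The contribution of a row [a] of the left factor, for an arc ending at [j] with label [t], once
    the right factor is averaged out: averaging forces the entries of [a *m x] before [j] to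
    vanish. *)
Definition row_weight (j : 'I_m) (t : F) (a : 'rV[F]_m) : algC :=
  if [forall c : 'I_m, (c < j)%N ==> ((a *m x) 0 c == 0)]
  then theta (- (t * (a *m x) 0 j)) else 0.

Definition row_supp (i k : nat) (a : 'rV[F]_m) : bool :=
  [forall c, (a 0 c != 0) ==> (i <= c < k)%N].

(* The value at 1 + x of the supercharacter of the single arc i -- j with label
   t. *)
Definition arc_char (i j : 'I_m) (t : F) : algC :=
  \sum_(a | row_supp i j a && (a 0 i == 1)) row_weight j t a.

(* The value at 1 + x of the sum of the trivial character and of all arc
   characters j -- k with i <= j < k. *)
Definition arcs_into (i : nat) (k : 'I_m) : algC :=
  \sum_(a | row_supp i k a) row_weight k 1 a.

Definition arc_factor (i j : 'I_m) (t : F) : algC :=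
  if t == 0 then 1 else arc_char i j t.

Definition arc_prod (M : 'M[F]_m) : algC :=
  \prod_(p : 'I_m * 'I_m) arc_factor p.1 p.2 (M p.1 p.2).

Lemma row_suppP i k (a : 'rV[F]_m) :
  reflect (forall c, a 0 c != 0 -> (i <= c < k)%N) (row_supp i k a).
Proof.
apply: (iffP forallP) => h c; first by move/implyP: (h c).
by apply/implyP/h.
Qed.

Lemma row_supp_out i k (a : 'rV[F]_m) (c : 'I_m) :
  row_supp i k a -> ~~ (i <= c < k)%N -> a 0 c = 0.
Proof. by move=> /row_suppP h nc; apply/eqP/(contraNT _ nc)/h. Qed.

Lemma row_suppZ i k t (a : 'rV[F]_m) : t != 0 ->
  row_supp i k (t *: a) = row_supp i k a.
Proof.
move=> nz; apply: eq_forallb => c.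
by rewrite mxE mulf_eq0 (negPf nz).
Qed.

Lemma row_weightZ (j : 'I_m) t (a : 'rV[F]_m) : t != 0 ->
  row_weight j 1 (t *: a) = row_weight j t a.
Proof.
move=> nz; rewrite /row_weight -scalemxAl mxE mul1r; congr (if _ then _ else _).
by apply: eq_forallb => c; rewrite mxE mulf_eq0 (negPf nz).
Qed.

Lemma arcs_intoE i (k : 'I_m) t : t != 0 ->
  arcs_into i k = \sum_(a | row_supp i k a) row_weight k t a.
Proof.
move=> nz; rewrite /arcs_into (reindex_inj (scalerI nz)).
by apply: eq_big => [a | a _]; rewrite ?row_suppZ ?row_weightZ.
Qed.

Lemma arc_prod_set_arc M (i j : 'I_m) t :
  arc_prod (set_arc M i j t) =
    arc_factor i j t * arc_prod (set_arc M i j 0).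
Proof.
rewrite /arc_prod (bigD1 (i, j)) //= mxE !eqxx; congr (_ * _).
rewrite [RHS](bigD1 (i, j)) //= mxE !eqxx /= {2}/arc_factor eqxx mul1r.
apply: eq_bigr => -[a b]; rewrite xpair_eqE /= => h.
by rewrite !mxE (negPf h).
Qed.

Lemma set_arc_id (M : 'M[F]_m) (i j : 'I_m) : set_arc M i j (M i j) = M.
Proof.
apply/matrixP => a b; rewrite mxE.
by case: ifP => // /andP[/eqP-> /eqP->].
Qed.

Lemma arc_prodE M (i j : 'I_m) :
  arc_prod M = arc_factor i j (M i j) * arc_prod (set_arc M i j 0).
Proof. by rewrite -arc_prod_set_arc set_arc_id. Qed.

Hypothesis theta_char : nontrivial_addchar theta.

(** The support condition leaves only the zero vector, of weight [theta 0]. *)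
Lemma arcs_into_diag (k : 'I_m) : arcs_into k k = 1.
Proof.
rewrite /arcs_into (bigD1 0) /=; last first.
  by apply/row_suppP => c; rewrite mxE eqxx.
rewrite big1 ?addr0 => [|a /andP[/row_suppP h /eqP]].
  rewrite /row_weight mul0mx mxE mulr0 oppr0 (addchar0 theta_char).
  by rewrite ifT //; apply/forallP => c; rewrite mxE eqxx implybT.
case; apply/rowP => c; rewrite mxE; apply/eqP/negPn/negP => /h.
by case: leqP => // /leq_trans h' /h'; rewrite ltnn.
Qed.

Hypothesis x_upper : strict_upper x.

Lemma mulmx_upper_eq (a b : 'rV[F]_m) (j : 'I_m) :
    (forall c : 'I_m, (c < j)%N -> a 0 c = b 0 c) ->
  forall c : 'I_m, (c <= j)%N -> (a *m x) 0 c = (b *m x) 0 c.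
Proof.
move=> h c cj; rewrite !mxE; apply: eq_bigr => r _.
have [cr | rc] := leqP c r; first by rewrite (strict_upperP _ x_upper) ?mulr0.
by rewrite h // (leq_trans rc).
Qed.

Lemma row_weight_addl (j : 'I_m) t (a b : 'rV[F]_m) :
    (forall c : 'I_m, (c <= j)%N -> (a *m x) 0 c = 0) ->
  row_weight j t (a + b) = row_weight j t b.
Proof.
move=> h; rewrite /row_weight mulmxDl [in X in - X]mxE h // add0r.
congr (if _ then _ else _); apply: eq_forallb => c; rewrite mxE.
by case: ltnP => //= cj; rewrite h ?add0r // ltnW.
Qed.

(** Sort the vectors by their entry at [i]: entry 0 makes the support start at [i.+1], and an entry
    [t != 0], scaled to 1, gives the arc character with label [t]. *)
Lemma arcs_into_step (i k : 'I_m) : (i < k)%N ->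
  arcs_into i k = arcs_into i.+1 k + \sum_(t | t != 0) arc_char i k t.
Proof.
move=> ik; rewrite /arcs_into (bigID (fun a : 'rV[F]_m => a 0 i == 0)) /=.
congr (_ + _).
  apply: eq_bigl => a; apply/andP/row_suppP => [[/row_suppP h a0] c nz | h].
    have := h c nz; rewrite [(i <= c)%N]leq_eqVlt.
    move=> /andP[/orP[/eqP e|->] ->] //.
    by move: nz; rewrite -(val_inj e) a0.
  split; last by apply: contraT => /h; rewrite ltnn.
  by apply/row_suppP => c /h/andP[/ltnW-> ->].
rewrite (partition_big (fun a : 'rV[F]_m => a 0 i) (fun t => t != 0)) /=;
  last by move=> a /andP[].
apply: eq_bigr => t nz; rewrite (reindex_inj (scalerI nz)) /arc_char /=.
apply: eq_big => [a | a _]; last by rewrite row_weightZ.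
rewrite row_suppZ // mxE -{3}[t]mulr1 (inj_eq (mulfI nz)).
by rewrite andbAC -andbA; case: eqP => [-> |]; rewrite ?mulr1 ?nz ?andbT ?andbF.
Qed.

(* If the first factor does not vanish at x, some vector a with entry 1 at i
   satisfies a x = 0 in the columns before l; translation by the truncation of
   a to the columns before j turns the second factor into a sum over vectors
   supported on the columns strictly between i and j. *)
Lemma arc_charM (i j l : 'I_m) (s t : F) :
    (i < j)%N -> (j < l)%N -> s != 0 ->
  arc_char i l t * arc_char i j s = arc_char i l t * arcs_into i.+1 j.
Proof.
move=> ij jl nz.
case: (pickP (fun a : 'rV[F]_m => [&& row_supp i l a, a 0 i == 1
    & [forall c : 'I_m, (c < l)%N ==> ((a *m x) 0 c == 0)]])); last first.
  move=> h; suff -> : arc_char i l t = 0 by rewrite !mul0r.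
  rewrite /arc_char big1 // => a /andP[sa ai]; rewrite /row_weight.
  by have := h a; rewrite sa ai /= => ->.
move=> a /and3P[sa /eqP ai /forallP ax]; congr (_ * _).
pose b : 'rV[F]_m := \row_c if (c < j)%N then a 0 c else 0.
have bx (c : 'I_m) : (c <= j)%N -> (b *m x) 0 c = 0.
  move=> cj; rewrite (@mulmx_upper_eq b a j) //; last first.
    by move=> c' c'j; rewrite mxE c'j.
  by apply/eqP; apply: (implyP (ax c)); apply: leq_ltn_trans jl.
rewrite (arcs_intoE _ _ nz) /arc_char (reindex_inj (addrI b)) /=.
apply: eq_big => [d | d _]; last exact: row_weight_addl.
(* Outside the columns strictly between [i] and [j], [b] is the unit vector at [i]; so adding [b]
   only affects the normalization at [i] there. *)
have bE (c : 'I_m) : (c <= i)%N || (j <= c)%N -> b 0 c = (c == i)%:R.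
  rewrite mxE; case: ltnP => [cj | jc _]; last first.
    by rewrite -val_eqE gtn_eqF // (leq_trans ij).
  rewrite orbF leq_eqVlt -val_eqE; case: eqP => [/val_inj-> // | _ /= ci].
  by rewrite (row_supp_out sa) // leqNgt ci.
apply/andP/row_suppP => [[/row_suppP sd] | sd].
  rewrite mxE bE ?leqnn // eqxx -subr_eq0 addrAC subrr add0r => di c nc.
  apply/andP; split.
    rewrite ltnNge; apply: contra nc => ci.
    move: ci; rewrite leq_eqVlt => /orP[/eqP/val_inj-> // | ci].
    apply: contraT => nc; have := sd c.
    rewrite mxE bE ?(ltnW ci) // -val_eqE (ltn_eqF ci) add0r => /(_ nc).
    by rewrite leqNgt ci.
  rewrite ltnNge; apply: contra nc => jc; apply: contraT => nc.
  have := sd c; rewrite mxE bE ?jc ?orbT //.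
  rewrite -val_eqE gtn_eqF ?(leq_trans ij) // add0r => /(_ nc).
  by rewrite ltnNge jc andbF.
split; last first.
  rewrite mxE bE ?leqnn // eqxx.
  suff /eqP-> : d 0 i == 0 by rewrite addr0.
  by apply: contraT => /sd; rewrite ltnn.
apply/row_suppP => c; rewrite mxE => nc; apply/andP; split.
  rewrite leqNgt; apply: contra nc => ci; rewrite bE ?(ltnW ci) //.
  rewrite -val_eqE (ltn_eqF ci) add0r; apply: contraT => /sd.
  by rewrite ltnNge (ltnW ci).
rewrite ltnNge; apply: contra nc => jc; rewrite bE ?jc ?orbT //.
rewrite -val_eqE gtn_eqF ?(leq_trans ij) // add0r; apply: contraT => /sd.
by rewrite [(c < j)%N]ltnNge jc andbF.
Qed.

(** For [i < k], each case of the recursion matches the splitting of [arcs_into i k] by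
    [arcs_into_step]. Emptiness of the column of the current endpoint persists along the recursion
    and excludes an arc from [i] to [k]. *)
Lemma star_arc_prod (mu : 'M[F]_m) (i k : 'I_m) :
    is_lsp mu -> (i <= k)%N -> (forall a, mu a k = 0) ->
  \sum_M star mu i k M * arc_prod M = arc_prod mu * arcs_into i k.
Proof.
pose ev (f : formal F m) := \sum_M f M * arc_prod M.
have evD f g : ev (f + g) = ev f + ev g.
  by rewrite -big_split; apply: eq_bigr => M _; rewrite ffunE mulrDl.
have ev0 : ev 0 = 0 by apply: big1 => M _; rewrite ffunE mul0r.
have ev_single M : ev (single M) = arc_prod M.
  rewrite /ev (bigD1 M) //= ffunE eqxx mul1r big1 ?addr0 // => N NM.
  by rewrite ffunE (negPf NM) mul0r.
have evS (P : pred F) (f : F -> formal F m) :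
    ev (\sum_(t | P t) f t) = \sum_(t | P t) ev (f t).
  exact: (big_morph ev evD ev0).
have [d] := ubnP (k - i); elim: d => // d IH in mu i k *.
move=> lt_d lmu ik ck; rewrite -/(ev _).
have /is_lspP[su hr hc] := lmu.
rewrite starE // /star_step; have [<- | neq] := eqVneq i k.
  by rewrite ev_single arcs_into_diag mulr1.
have lt_ik : (i < k)%N by rewrite ltn_neqAle ik (inj_eq (@ord_inj m)) neq.
have eS : ordS i = i.+1 :> nat.
  by rewrite /= modn_small // (leq_ltn_trans lt_ik).
have {}IH nu (l : 'I_m) : (i < l <= k)%N -> is_lsp nu ->
    (forall a, nu a l = 0) ->
    ev (star nu (ordS i) l) = arc_prod nu * arcs_into i.+1 l.
  move=> /andP[il lk] lnu cl; rewrite -eS; apply: IH; rewrite ?eS //.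
  apply: (@leq_trans (k - i)); last by rewrite -ltnS.
  by apply: (leq_ltn_trans (leq_sub2r _ lk)); rewrite ltn_sub2l.
have IHk := IH mu k; rewrite lt_ik leqnn in IHk.
rewrite (arcs_into_step lt_ik) mulrDr.
(* An arc from [i] to [l > k] turns each of the q - 1 summands [arc_char i k t] into
   [arcs_into i.+1 k]; with the leading term this makes q copies. *)
case: ifP => [/existsP[l /andP[kl ml]] | /existsPn hl].
  have evMn f r : ev (f *+ r) = ev f *+ r.
    by elim: r => [|r IHr]; rewrite ?mulr0n // !mulrS evD IHr.
  have e : arc_char i l (mu i l) * (\sum_(t | t != 0) arc_char i k t) =
      arc_char i l (mu i l) * arcs_into i.+1 k *+ #|F|.-1.
    rewrite mulr_sumr -(cardC1 (0 : F)) -sumr_const.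
    by apply: eq_bigr => t nz; rewrite arc_charM.
  rewrite evMn IHk // (arc_prodE mu i l) /arc_factor (negPf ml).
  set f := arc_char i l _ in e *; set R := arc_prod _.
  rewrite [f * R]mulrC -[in RHS]mulrA -[in RHS](mulrA R) e -mulrA.
  rewrite -mulrDr -mulrS prednK ?mulrnAr //.
  by apply/card_gt0P; exists 0.
rewrite ck eqxx /=; case: pickP => [j /andP[jk mj] | hj]; rewrite evD IHk //.
  (* Now the new arc from [i] to [k] is the longer one: by [arc_charM] its character replaces that
     of the arc from [i] to [j] by [arcs_into i.+1 j]. *)
  congr (_ + _); rewrite evS (arc_prodE mu i j) /arc_factor (negPf mj).
  have ij : (i < j)%N.
    by rewrite ltnNge; apply: contra mj => ji; rewrite (strict_upperP _ su).
  rewrite mulrAC mulr_sumr mulr_suml; apply: eq_bigr => t nz.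
  (* Moving the arc empties column [j], as the induction hypothesis at [j] requires. *)
  rewrite IH ?ij ?(ltnW jk) //; first last.
  - move=> a; rewrite !mxE (_ : j == k = false) ?andbF; last first.
      by rewrite -val_eqE ltn_eqF.
    rewrite eqxx andbT; case: eqP => // ai.
    by apply/eqP/negPn/negP => /hc/(_ mj).
  - apply: is_lsp_add => //; first exact: is_lsp_del.
      move=> b; rewrite mxE eqxx /=; case: eqP => // bj.
      by apply/eqP/negPn/negP => /hr/(_ mj).
    by move=> a; rewrite mxE ck if_same.
  rewrite arc_prod_set_arc /arc_factor (negPf nz).
  have -> : set_arc (set_arc mu i j 0) i k 0 = set_arc mu i j 0.
    rewrite -[RHS](set_arc_id _ i k); congr set_arc.
    by rewrite mxE ck if_same.
  by rewrite [LHS]mulrAC -(arc_charM t ij jk mj) (mulrC (arc_char i k t)).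
congr (_ + _); rewrite evS mulr_sumr; apply: eq_bigr => t nz.
rewrite ev_single arc_prod_set_arc /arc_factor (negPf nz) mulrC.
by congr (arc_prod _ * _); rewrite -[RHS](set_arc_id mu i k) ck.
Qed.

End ArcCharacters.

(** Every fiber of the orbit map has the size [k] of the stabilizer of [t], so averages over the
    group and over the orbit agree. *)
Lemma orbit_average (gT : finGroupType) (T : finType) (to : gT -> T -> T)
    (t : T) (f : T -> algC) :
    (forall s, to 1%g s = s) ->
    (forall a b s, to a (to b s) = to (a * b)%g s) ->
  #|gT|%:R^-1 * (\sum_g f (to g t))
    = #|[set to g t | g : gT]|%:R^-1 * \sum_(s in [set to g t | g : gT]) f s.
Proof.
move=> to1 toM; set O := [set _ | _ in _].
pose k := #|[pred g | to g t == t]|.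
have fiber s : s \in O -> #|[pred g | to g t == s]| = k.
  case/imsetP=> a _ ->; rewrite /k -!sum1_card (reindex_inj (mulgI a)) /=.
  apply: eq_bigl => g; rewrite !inE -toM; apply/eqP/eqP => [e | ->] //.
  by rewrite -[LHS]to1 -(mulVg a) -toM e toM mulVg to1.
have part (F : T -> algC) : \sum_g F (to g t) = k%:R * \sum_(s in O) F s.
  rewrite (partition_big (to^~ t) (mem O)) => [|g _]; last exact: imset_f.
  rewrite mulr_sumr; apply: eq_bigr => s sO; rewrite -(fiber s sO) mulr_natl.
  by rewrite -sumr_const; apply: eq_bigr => g /eqP->.
have cG : #|gT|%:R = k%:R * #|O|%:R :> algC.
  by have := part (fun=> 1); rewrite !sumr_const.
have k0 : k%:R != 0 :> algC.
  rewrite pnatr_eq0 -lt0n; apply/card_gt0P; exists 1%g.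
  by rewrite inE to1.
by rewrite part cG invfM mulrACA mulVf // mul1r.
Qed.

(** * Supercharacters as sums over left orbits *)

Section Supercharacters.

Variables (F : finFieldType) (theta : F -> algC).

Lemma dual_oppE n (l : dual F n) y : (- l) y = - l y.
Proof. by rewrite /dual_apply ffunE. Qed.

Lemma dual_actN n (u v : unip F n) (l : dual F n) :
  dual_act u (- l) v = - dual_act u l v.
Proof.
apply: val_inj; apply/ffunP => y.
rewrite -[LHS]/(dual_act u (- l) v y) -[RHS]/((- dual_act u l v) y).
by rewrite dual_oppE !dual_actE dual_oppE.
Qed.

(** Up to the factor [#|left_orbit l|], the supercharacter is an average over pairs of group
    elements. The average over the left element becomes a sum over the left orbit, and the right
    average remains. *)
Lemma superchar_left_orbit n (l : dual F n) (u : unip F n) :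
  superchar theta l u =
    \sum_(nu in left_orbit l)
       #|{: unip F n}|%:R^-1
       * \sum_(h : unip F n) theta (- nu (nilp_lr 1%g (sub1 u) h)).
Proof.
pose to1 (g : unip F n) nu := dual_act g nu 1%g.
(* The right factor composes in the opposite order; its inverse makes [to2] a left action of the
   product group. *)
pose to2 (g : unip F n * unip F n) nu := dual_act g.1 nu g.2^-1%g.
have E2 (nu : dual F n) :
    two_sided_orbit nu = [set to2 g nu | g : unip F n * unip F n].
  apply/setP => s; apply/imset2P/imsetP => [[g h _ _ ->] | [[g h] _ ->]].
    by exists (g, h^-1%g); rewrite // /to2 invgK.
  by exists g h^-1%g.
have cN : #|two_sided_orbit (- l)| = #|two_sided_orbit l|.
  rewrite -(card_imset _ (@oppr_inj (dual F n))); congr #|pred_of_set _|.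
  apply/setP => s; apply/imsetP/imset2P => [[_ /imset2P[g h _ _ ->] ->] |].
    by exists g h; rewrite // dual_actN opprK.
  case=> g h _ _ ->; exists (dual_act g (- l) h).
    exact: imset2_f.
  by rewrite dual_actN opprK.
have nz (T : finType) (A : {set T}) a : a \in A -> #|A|%:R != 0 :> algC.
  by move=> aA; rewrite pnatr_eq0 -lt0n; apply/card_gt0P; exists a.
rewrite [LHS]cfunE; rewrite -cN -mulrA E2 -orbit_average; first last.
- by move=> [a a'] [b b'] s; rewrite /to2 /= dual_actM invMg.
- by move=> s; rewrite /to2 /= invg1 dual_act1.
pose f (nu : dual F n) := #|{: unip F n}|%:R^-1
  * \sum_(h : unip F n) theta (- nu (nilp_lr 1%g (sub1 u) h)).
rewrite -[RHS]/(\sum_(nu in left_orbit l) f nu).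
have L0 : #|left_orbit l|%:R != 0 :> algC.
  by apply: (nz _ _ (to1 1%g l)); apply: imset_f.
apply: (mulfI (invr_neq0 L0)); rewrite mulKf //.
rewrite -[RHS](@orbit_average _ _ to1 l f); first last.
- by move=> a b s; rewrite /to1 dual_actM mulg1.
- exact: dual_act1.
rewrite card_prod natrM invfM -mulrA; congr (_ * _).
rewrite -(pair_bigA _ (fun g h => theta (to2 (g, h) (- l) (sub1 u)))) /=.
rewrite mulr_sumr; apply: eq_bigr => g _; congr (_ * _).
apply: eq_bigr => h _; rewrite /to2 /to1 dual_actN dual_oppE !dual_actE.
congr (theta (- l _)); apply: val_inj.
by rewrite invgK invg1 /= mulmx1 mul1mx mulmxA.
Qed.

End Supercharacters.

Lemma sum_val (T : finType) (P : pred T) (sT : subFinType P) (f : T -> algC) :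
  \sum_(s : sT) f (val s) = \sum_(t | P t) f t.
Proof.
rewrite [RHS](reindex_omap (val : sT -> T) insub) => [|t Pt].
  by apply: eq_bigl => s; rewrite valP valK eqxx.
by rewrite insubT /= SubK.
Qed.

(** * Factorization of supercharacters over arcs *)

Section SupercharactersOfPartitions.

Variables (F : finFieldType) (theta : F -> algC).
Hypothesis theta_char : nontrivial_addchar theta.

Definition pairing n (M y : 'M[F]_n) : F := \sum_i \sum_j M i j * y i j.

Lemma functionalE n (M : 'M[F]_n) (y : Defs.nilp F n) :
  functional M y = pairing M y.
Proof. by rewrite /dual_apply ffunE. Qed.

Lemma pairingDr n (M y z : 'M[F]_n) :
  pairing M (y + z) = pairing M y + pairing M z.
Proof.
rewrite -big_split; apply: eq_bigr => i _; rewrite -big_split.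
by apply: eq_bigr => j _; rewrite mxE mulrDr.
Qed.

Lemma pairing_mulr n (M y z : 'M[F]_n) :
  pairing M (y *m z) = \sum_j \sum_c (\sum_i M i j * y i c) * z c j.
Proof.
rewrite /pairing exchange_big; apply: eq_bigr => j _.
rewrite (eq_bigr (fun i => \sum_c M i j * y i c * z c j)) => [|i _]; last first.
  by rewrite mxE mulr_sumr; apply: eq_bigr => c _; rewrite mulrA.
by rewrite exchange_big; apply: eq_bigr => c _; rewrite mulr_suml.
Qed.

(** With [h = 1 + z], this averages an additive character over the strictly upper triangular [z]; it
    is trivial exactly when the coefficients of all entries [z c j] with [c < j] vanish. *)
Lemma right_average n (M y : 'M[F]_n) :
  #|{: unip F n}|%:R^-1 * (\sum_(h : unip F n) theta (- pairing M (y *m h)))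
  = if [forall j : 'I_n, forall c : 'I_n,
          (c < j)%N ==> (\sum_i M i j * y i c == 0)]
    then theta (- pairing M y) else 0.
Proof.
have sumU (f : 'M[F]_n -> algC) :
    \sum_(h : unip F n) f h = \sum_(z | strict_upper z) f (1%:M + z).
  rewrite (sum_val _ f) (reindex_inj (addrI 1%:M)); apply: eq_bigl => z.
  by rewrite unitriangularE addrAC subrr add0r.
have cU : #|{: unip F n}|%:R = #|@strict_upper F n|%:R :> algC.
  by have := sumU (fun=> 1); rewrite !sumr_const.
rewrite (sumU (fun h => theta (- pairing M (y *m h)))).
under eq_bigr => z _ do rewrite mulmxDr mulmx1 pairingDr opprD addcharD //.
rewrite -mulr_sumr.
have := @sum_character 'M[F]_n (@strict_upper F n)
  (fun z => theta (- pairing M (y *m z))).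
move=> ->; first last.
- by move=> v w; rewrite mulmxDr pairingDr opprD addcharD.
- move=> v w vS; apply/idP/idP => wS; last first.
    by rewrite -[v]scale1r strict_upperZD.
  have -> : w = -1 *: v + (v + w) by rewrite scaleN1r addKr.
  exact: strict_upperZD.
have nzU : #|@strict_upper F n|%:R != 0 :> algC.
  rewrite pnatr_eq0 -lt0n; apply/card_gt0P; exists 0.
  exact: strict_upper0.
rewrite cU; set b1 := [forall z, _]; set b2 := [forall j, _].
have -> : b1 = b2.
  apply/forallP/forallP => [h j | h z].
    apply/forallP => c; apply/implyP => cj.
    suff /eqP : - (\sum_i M i j * y i c) = 0 by rewrite oppr_eq0.
    apply: (addchar_scale_trivial theta_char) => t.
    (* Multiples of a matrix unit isolate a single coefficient. *)
    have dS : strict_upper (t *: delta_mx c j : 'M[F]_n).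
      rewrite -[_ *: _]addr0 strict_upperZD ?strict_upper0 //.
      exact: nilp_delta_subproof.
    have /implyP/(_ dS) := h (t *: delta_mx c j).
    rewrite pairing_mulr (bigD1 j) //= (bigD1 c) //= !mxE !eqxx.
    rewrite mulr1 [X in _ + X]big1 => [|j' jj']; last first.
      by rewrite big1 // => c' _; rewrite !mxE (negPf jj') andbF !mulr0.
    rewrite addr0 [X in _ + X]big1 => [|c' cc']; last first.
      by rewrite !mxE (negPf cc') !mulr0.
    by rewrite addr0 mulrN mulrC => /eqP.
  apply/implyP => /strict_upperP zS; rewrite pairing_mulr big1.
    by rewrite oppr0 (addchar0 theta_char).
  move=> j _; apply: big1 => c _; have [jc | cj] := leqP j c.
    by rewrite zS ?mulr0.
  by have /forallP/(_ c)/implyP/(_ cj)/eqP-> := h j; rewrite mul0r.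
by case: ifP; rewrite ?mulr0 // mulrC mulfK.
Qed.

(* The rows of the unitriangular matrices, truncated so as to represent the left
   orbit of lam without repetition. *)
Definition orbit_row n (lam : 'M[F]_n) (i : 'I_n) (a : 'rV[F]_n) : bool :=
  (a 0 i == 1) && [forall c : 'I_n, (a 0 c != 0) && (c != i) ==>
     (i < c)%N && [exists j : 'I_n, (c < j)%N && (lam i j != 0)]].

Definition orbit_rep n (lam : 'M[F]_n) : {set unip F n} :=
  [set g : unip F n | [forall i, orbit_row lam i (row i g)]].

Lemma orbit_rep_entry n (lam : 'M[F]_n) (g : unip F n) (i c : 'I_n) :
    g \in orbit_rep lam -> (i < c)%N ->
    ~~ [exists j : 'I_n, (c < j)%N && (lam i j != 0)] ->
  g i c = 0.
Proof.
rewrite inE => /forallP/(_ i)/andP[_ /forallP/(_ c)]; rewrite mxE => h ic.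
apply: contraNeq => nz; move: h; rewrite nz -val_eqE gtn_eqF //=.
by case/andP.
Qed.

Lemma dual_act_inv n (g : unip F n) (lam : 'M[F]_n) (y : Defs.nilp F n) :
  dual_act g^-1%g (functional lam) 1%g y = pairing lam (g *m y).
Proof. by rewrite dual_actE invgK invg1 functionalE /= mulmx1. Qed.

(** In [pairing lam (g *m y)], the entry [g i c] only meets [y c j] with [lam i j != 0], which
    vanishes unless [c < j]; the remaining entries of [g] above the diagonal may be set to 0. *)
Lemma left_orbit_functional n (lam : 'M[F]_n) :
  left_orbit (functional lam) =
    [set dual_act g^-1%g (functional lam) 1%g | g in orbit_rep lam].
Proof.
apply/setP => s; apply/imsetP/imsetP => [[g _ ->] | [g _ ->]]; last first.
  by exists g^-1%g.
pose g' := \matrix_(i, c)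
  if (i < c)%N && ~~ [exists j : 'I_n, (c < j)%N && (lam i j != 0)] then 0
  else g^-1%g i c.
have g'U : unitriangular g'.
  apply/unitriangularP => i j ji; rewrite mxE ltnNge ji.
  by rewrite (unitriangularP _ (umxP _)).
exists (Unip g'U).
  rewrite inE; apply/forallP => i; apply/andP; split.
    by rewrite !mxE ltnn (unitriangularP _ (umxP _)) ?eqxx.
  apply/forallP => c; apply/implyP => /andP[]; rewrite !mxE.
  case: ifP => [|+ nz ci]; first by rewrite eqxx.
  have -> : (i < c)%N.
    rewrite ltnNge; apply: contra nz => ic.
    by rewrite (unitriangularP _ (umxP _)) // [i == c]eq_sym (negPf ci).
  by move/negbT; rewrite negbK.
apply: val_inj; apply/ffunP => y.
rewrite -[LHS]/(dual_act g (functional lam) 1%g y).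
rewrite -[RHS]/(dual_act (Unip g'U)^-1%g (functional lam) 1%g y).
rewrite -{1}[g]invgK !dual_act_inv.
apply: eq_bigr => i _; apply: eq_bigr => j _.
rewrite !mxE; have [-> | nz] := eqVneq (lam i j) 0; first by rewrite !mul0r.
congr (_ * _); apply: eq_bigr => c _; rewrite [in RHS]mxE.
case: ifP => // /andP[_ /existsPn/(_ j)]; rewrite nz andbT -leqNgt => jc.
by rewrite (strict_upperP _ (nmxP y)) ?mulr0.
Qed.

(** The value at the matrix unit [(c, j)] is [lam i j * g i c], since only the arc from [i] ends at
    [j]; this recovers every entry of [g] that is not prescribed. *)
Lemma orbit_rep_inj n (lam : 'M[F]_n) : is_lsp lam ->
  {in orbit_rep lam &,
     injective (fun g : unip F n => dual_act g^-1%g (functional lam) 1%g)}.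
Proof.
move=> /is_lspP[su hr hc] g g' gT g'T /= e; apply: val_inj.
apply/matrixP => i c /=; have [ci | ic] := leqP c i.
  by rewrite !(unitriangularP _ (umxP _)).
have [/existsP[j /andP[cj nz]] | no] :=
  boolP [exists j : 'I_n, (c < j)%N && (lam i j != 0)]; last first.
  by rewrite !(@orbit_rep_entry _ lam).
have E (h : unip F n) :
    dual_act h^-1%g (functional lam) 1%g (Nilp (nilp_delta_subproof F cj))
    = lam i j * h i c.
  rewrite dual_act_inv pairing_mulr (bigD1 j) //= (bigD1 c) //= !mxE !eqxx.
  rewrite mulr1 (bigD1 i) //= [X in _ + X]big1 => [|j' jj']; last first.
    by rewrite big1 // => c' _; rewrite !mxE (negPf jj') andbF mulr0.
  rewrite addr0 [X in _ + X]big1 => [|c' cc']; last first.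
    by rewrite !mxE (negPf cc') mulr0.
  rewrite addr0 [X in _ + X]big1 => [|i' ii']; last first.
    suff /eqP-> : lam i' j == 0 by rewrite mul0r.
    by apply: contraR ii' => /hc/(_ nz)->.
  by rewrite addr0.
by have := E g; rewrite e E => /(mulfI nz).
Qed.

Lemma sum_rows n (J : 'I_n -> pred 'rV[F]_n) (f : 'I_n -> 'rV[F]_n -> algC) :
  \sum_(M : 'M[F]_n | [forall i, J i (row i M)]) \prod_i f i (row i M)
  = \prod_i \sum_(a | J i a) f i a.
Proof.
rewrite bigA_distr_big_dep.
rewrite (reindex_onto (fun g : {ffun 'I_n -> 'rV[F]_n} => \matrix_i g i)
  (fun M => [ffun i => row i M])) => [|M _]; last first.
  by apply/row_matrixP => i; rewrite rowK ffunE.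
apply: eq_big => [g | g _]; last by apply: eq_bigr => i _; rewrite rowK.
rewrite [X in _ && X](_ : _ = true) ?andbT.
  by apply: eq_forallb => i; rewrite rowK.
by apply/eqP/ffunP => i; rewrite ffunE rowK.
Qed.

Lemma superchar_arc_prod n (lam : 'M[F]_n) (u : unip F n) : is_lsp lam ->
  superchar theta (functional lam) u = arc_prod theta (umx u - 1%:M) lam.
Proof.
move=> lsp_lam; have /is_lspP[su hr hc] := lsp_lam.
set x := _ - _.
rewrite superchar_left_orbit left_orbit_functional.
rewrite big_imset; last exact: orbit_rep_inj.
pose f i (a : 'rV[F]_n) :=
  \prod_(j | lam i j != 0) row_weight theta x j (lam i j) a.
pose Phi (g : 'M[F]_n) := \prod_i f i (row i g).
(* Each column holds at most one arc, so the condition of [right_average] splits into one condition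
   per arc. *)
transitivity (\sum_(g in orbit_rep lam) Phi g).
  apply: eq_bigr => g _.
  under eq_bigr => h _.
    rewrite dual_act_inv /= mul1mx mulmxA; over.
  rewrite right_average // /Phi /f.
  have rowE i c : (row i g *m x) 0 c = (g *m x) i c by rewrite -row_mul mxE.
  case: ifP => [/forallP h | /negbT/forallPn[j]]; last first.
    case/forallPn=> c; rewrite negb_imply => /andP[cj nz].
    have [i nzi] : exists i, lam i j * (g *m x) i c != 0.
      apply/existsP; apply: contraR nz => /existsPn nz.
      by apply/eqP/big1 => i _; apply/eqP/negPn.
    move: nzi; rewrite mulf_eq0 negb_or => /andP[lij yic].
    rewrite (bigD1 i) //= (bigD1 j) //=.
    rewrite [X in X * _ * _]/row_weight ifF ?mul0r //.
    apply/negbTE/forallPn; exists c; rewrite cj /= rowE; exact: yic.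
  rewrite -sumrN addchar_sum //; apply: eq_bigr => i _.
  rewrite -sumrN addchar_sum // [RHS]big_mkcond; apply: eq_bigr => j _.
  case: ifP => [nz | /negbT/negPn/eqP->]; last first.
    by rewrite mul0r oppr0 addchar0.
  rewrite /row_weight rowE ifT //; apply/forallP => c; apply/implyP => cj.
  have := forallP (h j) c; rewrite cj rowE /= (bigD1 i) //= big1 ?addr0.
    by rewrite mulf_eq0 (negPf nz).
  move=> i' ii'; suff /eqP-> : lam i' j == 0 by rewrite mul0r.
  by apply: contraR ii' => /hc/(_ nz)->.
(* The row conditions already force unitriangularity, so the rows vary independently among all
   matrices. *)
transitivity (\sum_(g : 'M[F]_n | [forall i, orbit_row lam i (row i g)]) Phi g).
  rewrite big_mkcond; under eq_bigr => g _ do rewrite inE.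
  rewrite (sum_val _ (fun g : 'M[F]_n =>
    if [forall i, orbit_row lam i (row i g)] then Phi g else 0)).
  rewrite -big_mkcondr; apply: eq_bigl => g; apply: andb_idl => /forallP h.
  apply/unitriangularP => i j ji; have /andP[/eqP] := h i.
  rewrite mxE => gii /forallP/(_ j); rewrite mxE.
  have [<- _ | ij] := eqVneq i j; first exact: gii.
  rewrite andbT ltnNge ji /= implybF negbK => /eqP.
  by [].
rewrite sum_rows /arc_prod -(pair_bigA _ (fun i j =>
  arc_factor theta x i j (lam i j))) /=.
apply: eq_bigr => i _; rewrite /f.
(* At most one arc starts at [i]. If there is none, only the unit vector at [i] remains, weighted by
   an empty product. *)
case: (pickP (fun j => lam i j != 0)) => [j nz | no].
  have one k : k != j -> lam i k = 0.
    by move=> kj; apply/eqP; apply: contraR kj => /hr/(_ nz)->.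
  rewrite (bigD1 j) //= [X in _ * X]big1 => [|k kj]; last first.
    by rewrite /arc_factor one ?eqxx.
  rewrite mulr1 /arc_factor (negPf nz) /arc_char.
  apply: eq_big => [a | a _]; last first.
    rewrite (bigD1 j) //= big1 ?mulr1 // => k /andP[nzk kj].
    by rewrite one ?eqxx in nzk.
  rewrite /orbit_row andbC; apply: andb_id2r => /eqP ai.
  apply/forallP/row_suppP => [h c nzc | h c].
    have := h c; rewrite nzc; have [-> _|_ /=] := eqVneq c i.
      rewrite leqnn ltnNge; apply: contra nz => ji.
      by rewrite (strict_upperP _ su).
    case/andP=> /ltnW-> /existsP[k /andP[ck nzk]].
    by rewrite (hr _ _ _ nz nzk).
  apply/implyP=> /andP[/h/andP[ic cj] ci].
  rewrite ltn_neqAle ic (inj_eq (@ord_inj n)) eq_sym ci /=.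
  by apply/existsP; exists j; rewrite cj.
rewrite [RHS]big1 => [|j _]; last first.
  by rewrite /arc_factor; move/negbT/negPn: (no j) => ->.
rewrite (big_pred1 (delta_mx 0 i)) => [|a]; first by rewrite big_pred0.
apply/andP/eqP => [[/eqP ai /forallP h] | ->].
  apply/rowP => c; rewrite mxE eqxx /=; have [-> // | ci] := eqVneq c i.
  apply/eqP; apply: contraTT (h c) => nz; rewrite nz ci negb_and.
  by apply/orP; right; apply/existsPn => k; rewrite no andbF.
rewrite mxE !eqxx; split=> //; apply/forallP => c; rewrite mxE eqxx /=.
by case: (c == i); rewrite ?andbF // eqxx.
Qed.

End SupercharactersOfPartitions.

(** * Induction, restriction and the permutation character *)

Section Induction.

Variables (F : finFieldType) (theta : F -> algC).
Hypothesis theta_char : nontrivial_addchar theta.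

Lemma extmx_sub1 n (u : 'M[F]_n) : extmx 1 u - 1%:M = extmx 0 (u - 1%:M).
Proof.
apply/matrixP => i j; rewrite !mxE !extmxE.
case: unliftP => [i' -> | ->]; case: unliftP => [j' -> | ->]; rewrite ?mxE.
- by rewrite (inj_eq lift_inj).
- by rewrite eq_sym (negPf (neq_lift _ _)) subrr.
- by rewrite (negPf (neq_lift _ _)) subrr.
- by rewrite eqxx subrr.
Qed.

(** Vectors supported before [lift ord_max j] vanish at the last index, so extension by 0 matches
    the two sums. *)
Lemma arc_char_extmx n (x : 'M[F]_n) (i j : 'I_n) t :
  arc_char theta (extmx 0 x) (lift ord_max i) (lift ord_max j) t
  = arc_char theta x i j t.
Proof.
pose e (a : 'rV[F]_n) : 'rV[F]_n.+1 :=
  \row_c oapp (fun c' => a 0 c') 0 (unlift ord_max c).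
have eE a c : e a 0 (lift ord_max c) = a 0 c by rewrite mxE liftK.
have eM a c : (e a *m extmx 0 x) 0 (lift ord_max c) = (a *m x) 0 c.
  rewrite !mxE (bigD1_ord ord_max) //= extmxE unlift_none liftK mulr0 add0r.
  by apply: eq_bigr => r _; rewrite extmxE !liftK eE.
rewrite /arc_char (reindex_onto e (fun a => \row_c a 0 (lift ord_max c))).
  apply: eq_big => [a | a _].
    rewrite (_ : \row_c e a 0 (lift ord_max c) = a) ?eqxx ?andbT; last first.
      by apply/rowP => c; rewrite mxE eE.
    rewrite eE !lift_max; congr (_ && _).
    apply/row_suppP/row_suppP => h c.
      by rewrite -eE => /h; rewrite lift_max.
    case: (unliftP ord_max c) => [c' -> | ->].
      by rewrite eE lift_max; apply: h.
    by rewrite mxE unlift_none eqxx.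
  rewrite /row_weight eM; congr (if _ then _ else _).
  apply/forallP/forallP => h c.
    by have := h (lift ord_max c); rewrite lift_max eM lift_max.
  apply/implyP; case: (unliftP ord_max c) => [c' -> | ->].
    by rewrite eM !lift_max; apply/implyP.
  by rewrite lift_max ltnNge ltnW.
move=> a /andP[sa _]; apply/rowP => c; rewrite mxE.
case: unliftP => [c' -> | ->]; rewrite /= ?mxE //.
rewrite (row_supp_out sa) // negb_and !lift_max -leqNgt.
by rewrite (ltnW (ltn_ord j)) orbT.
Qed.

Lemma arc_prod_extmx n (x mu : 'M[F]_n) :
  arc_prod theta (extmx 0 x) (extmx 0 mu) = arc_prod theta x mu.
Proof.
rewrite /arc_prod -(pair_bigA _ (fun i j =>
  arc_factor theta (extmx 0 x) i j (extmx 0 mu i j))).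
rewrite -(pair_bigA _ (fun i j => arc_factor theta x i j (mu i j))) /=.
rewrite (bigD1_ord ord_max) //= big1 ?mul1r => [|j _]; last first.
  rewrite extmxE unlift_none; case: unliftP => [j' _ | _];
    by rewrite /arc_factor eqxx.
apply: eq_bigr => i _; rewrite (bigD1_ord ord_max) //= extmxE unlift_none liftK.
rewrite {1}/arc_factor eqxx mul1r; apply: eq_bigr => j _.
by rewrite extmxE !liftK /arc_factor arc_char_extmx.
Qed.

Lemma res_superchar n (mu : lsp F n) :
  'Res[usub F n] (superchar theta (functional (extmx 0 mu)))
  = cfIsom (unip_ext_isom F n) (superchar theta (functional mu)).
Proof.
have [lsp_ext _] := extmx_lsp mu.
apply/cfun_inP => v vH.
have /morphimP[w _ _ vE] : v \in (@unip_ext F n @* 'U_n(F))%g.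
  by rewrite morphim_unip_ext.
rewrite cfResE ?subsetT // vE cfIsomE ?inE //.
rewrite !superchar_arc_prod //; last exact: (valP mu).
by rewrite /= extmx_sub1 arc_prod_extmx.
Qed.

(** Functionals on the last column; their Fourier sums detect membership in [usub]. *)
Definition last_col n (d : 'rV[F]_n.+1) : 'M[F]_n.+1 :=
  \matrix_(i, j) if j == ord_max then d 0 i else 0.

Lemma pairing_last_col n (d : 'rV[F]_n.+1) y :
  pairing (last_col d) y = (d *m y) 0 ord_max.
Proof.
rewrite mxE; apply: eq_bigr => i _; rewrite (bigD1 ord_max) //= mxE eqxx.
by rewrite big1 ?addr0 // => j /negPf nj; rewrite mxE nj mul0r.
Qed.

Definition last0 n (d : 'rV[F]_n.+1) := d 0 ord_max == 0.

Lemma last0E n (d : 'rV[F]_n.+1) : row_supp 0 (ord_max : 'I_n.+1) d = last0 d.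
Proof.
apply/row_suppP/eqP => [h | d0 c nz].
  by apply/eqP; apply: contraT => /h; rewrite ltnn.
rewrite /= ltn_neqAle leq_ord andbT.
by apply: contraNneq nz => e; rewrite (_ : c = ord_max) ?d0 //; apply: val_inj.
Qed.

(** The map [p] reads off the last column above the diagonal; its fiber over [d] is the left coset
    of [usub] by [1 + last_col d]. *)
Lemma card_unipS n :
  #|{: unip F n.+1}| = (#|@last0 n| * #|usub F n|)%N.
Proof.
pose p (y : unip F n.+1) : 'rV[F]_n.+1 :=
  \row_i (if i == ord_max then 0 else y i ord_max).
rewrite -[LHS]sum1_card (partition_big p (@last0 n)) /=; last first.
  by move=> y _; rewrite /last0 mxE eqxx.
rewrite -sum_nat_const; apply: eq_big => // d /eqP d0.
have tU : unitriangular (1%:M + last_col d).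
  rewrite unitriangularE addrAC subrr add0r; apply/strict_upperP => i j ji.
  rewrite mxE; case: eqP => // ej; suff -> : i = ord_max by [].
  by apply/val_inj/eqP; rewrite eqn_leq leq_ord -ej.
rewrite -[RHS]sum1_card (reindex_inj (mulgI (Unip tU))); apply: eq_bigl => h.
have tE i : (Unip tU * h)%g i ord_max = h i ord_max + d 0 i.
  rewrite /= mulmxDl mul1mx mxE; congr (_ + _).
  rewrite mxE (bigD1 ord_max) //= mxE eqxx (unitriangularP _ (umxP h)) // eqxx.
  by rewrite mulr1 big1 ?addr0 // => j /negPf nj; rewrite mxE nj mul0r.
rewrite inE; apply/eqP/forallP => [e i | e].
  apply/implyP => lt_in; move/rowP/(_ i): e; rewrite mxE tE ifN; last first.
    by rewrite -val_eqE ltn_eqF.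
  by move/eqP; rewrite -subr_eq0 addrK.
apply/rowP => i; rewrite mxE tE; case: eqP => [-> // | /eqP ni].
have /eqP-> : h i ord_max == 0; last by rewrite add0r.
have /implyP := e i; apply; rewrite ltn_neqAle leq_ord andbT.
by rewrite (inj_eq (@ord_inj n.+1) i ord_max).
Qed.

(** One has [u ^ y = 1 + y^-1 (u - 1) y], and the invertible left factor [y^-1] does not affect
    whether a column vanishes. *)
Lemma conj_usub n (u y : unip F n.+1) :
  ((u ^ y)%g \in usub F n) = (col ord_max ((umx u - 1%:M) *m y) == 0).
Proof.
have uy := unitriangular_unit (umxP y).
have e : umx (u ^ y)%g = 1%:M + invmx y *m ((umx u - 1%:M) *m y).
  by rewrite /= mulmxBl mul1mx mulmxBr mulVmx // addrC subrK.
transitivity (col ord_max (invmx y *m ((umx u - 1%:M) *m y)) == 0).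
  rewrite inE; apply/forallP/eqP => [h | /colP h i].
    apply/colP => i; rewrite !mxE.
    have [-> | ni] := eqVneq i ord_max.
      have := unitriangularP _ (umxP (u ^ y)%g) ord_max ord_max (leqnn _).
      by rewrite e mxE [X in X + _]mxE eqxx => /eqP; rewrite -subr_eq0 addrAC
        subrr add0r mxE => /eqP.
    have /implyP := h i; rewrite e [X in X == 0]mxE [X in X + _]mxE (negPf ni).
    rewrite add0r mxE => h'; apply/eqP/h'.
    by rewrite ltn_neqAle leq_ord (inj_eq (@ord_inj n.+1) i ord_max) ni.
  apply/implyP => lt_in; have := h i; rewrite [LHS]mxE [RHS]mxE => hi.
  rewrite e mxE hi addr0 mxE.
  by rewrite -val_eqE ltn_eqF.
rewrite !colE -mulmxA.
apply/eqP/eqP => [h | ->]; last by rewrite mulmx0.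
have uVy : invmx y \in unitmx by rewrite unitmx_inv.
by apply: (can_inj (mulKmx uVy)); rewrite h mulmx0.
Qed.

(** After Fourier expansion of the indicator of [usub], the sum over conjugating elements [y] is
    computed by [right_average] with [M = last_col d], and each [d] yields one term of
    [arcs_into]. *)
Lemma ind_one n (u : unip F n.+1) :
  'Ind['U_n.+1(F), usub F n] 1 u = arcs_into theta (umx u - 1%:M) 0 ord_max.
Proof.
set x := _ - _; pose K := #|@last0 n|.
have K0 : K%:R != 0 :> algC.
  rewrite pnatr_eq0 -lt0n; apply/card_gt0P; exists 0.
  by rewrite unfold_in /last0 mxE.
have H0 : #|usub F n|%:R != 0 :> algC.
  by rewrite pnatr_eq0 -lt0n cardG_gt0.
have fourier (y : unip F n.+1) : ((u ^ y)%g \in usub F n)%:R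
    = K%:R^-1 * \sum_(d | last0 d) theta (- pairing (last_col d) (x *m y)).
  have D d d' : pairing (last_col (d + d')) (x *m y)
      = pairing (last_col d) (x *m y) + pairing (last_col d') (x *m y).
    by rewrite !pairing_last_col mulmxDl mxE.
  rewrite (sum_character (S := @last0 n)
    (psi := fun d => theta (- pairing (last_col d) (x *m y)))); first last.
  - by move=> d d'; rewrite D opprD addcharD.
  - by move=> d d' /eqP d0; rewrite /last0 mxE d0 add0r.
  rewrite conj_usub -/x; set b := [forall d, _].
  suff -> : (col ord_max (x *m y) == 0) = b.
    by case: b; rewrite ?mulr0 // mulVf.
  have xyU : strict_upper (x *m y).
    by rewrite strict_upper_mulr ?umxP // -unitriangularE umxP.
  apply/eqP/forallP => [/colP h d | h].
    rewrite pairing_last_col mxE big1 ?oppr0 ?addchar0 ?eqxx ?implybT // => r _.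
    by have := h r; rewrite !mxE => ->; rewrite mulr0.
  apply/colP => r; rewrite [RHS]mxE [LHS]mxE.
  (* The last entry vanishes by strict triangularity; at any other [r] the multiples of
     [delta_mx 0 r] satisfy [last0] and serve as tests. *)
  have [-> | nr] := eqVneq r ord_max; first by rewrite (strict_upperP _ xyU).
  apply/eqP; rewrite -oppr_eq0; apply/eqP.
  apply: (addchar_scale_trivial theta_char) => t.
  have := h (t *: delta_mx 0 r); rewrite /last0 !mxE [ord_max == r]eq_sym.
  rewrite (negPf nr) andbF mulr0 eqxx /= pairing_last_col -scalemxAl -rowE.
  rewrite !mxE => /eqP<-.
  by rewrite mulrN.
rewrite cfIndE ?subsetT //.
under eq_bigr => y _ do rewrite cfun1E fourier.
rewrite -mulr_sumr exchange_big /= mulrA /arcs_into.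
have cU := card_unipS n.
have U0 : #|{: unip F n.+1}|%:R != 0 :> algC.
  by rewrite cU natrM mulf_neq0.
(* The normalizations of induction and of Fourier inversion combine into an average over the whole
   group. *)
have -> : #|usub F n|%:R^-1 / K%:R = #|{: unip F n.+1}|%:R^-1 :> algC.
  by rewrite cU natrM invfM mulrC.
rewrite mulr_sumr; apply: eq_big => [d | d _]; first by rewrite last0E.
rewrite (eq_bigl xpredT) => [|y]; last by rewrite inE.
rewrite right_average // /row_weight mul1r pairing_last_col.
have E j c : \sum_i last_col d i j * x i c
    = if j == ord_max then (d *m x) 0 c else 0.
  case: ifP => nj; last by rewrite big1 // => i _; rewrite mxE nj mul0r.
  by rewrite mxE; apply: eq_bigr => i _; rewrite mxE nj.
congr (if _ then _ else _); apply/forallP/forallP => [h c | h j].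
  by have /forallP/(_ c) := h ord_max; rewrite E eqxx.
apply/forallP => c; rewrite E.
have [-> | _] := eqVneq j ord_max; first exact: h.
by rewrite eqxx implybT.
Qed.

End Induction.

Unset Implicit Arguments.

Theorem theorem4p2 (F : finFieldType) (theta : F -> algC)
    (theta_char : nontrivial_addchar theta)
    (n : nat) (n_gt0 : (0 < n)%N) (mu : lsp F n) :
  'Ind['U_n.+1(F)]
      (cfIsom (unip_ext_isom F n) (superchar theta (functional mu)))
  = \sum_(lam : lsp F n.+1)
      star (extmx 0 mu) ord0 ord_max lam *: superchar theta (functional lam).
Proof.
have [lsp_ext ext0] := extmx_lsp mu.
apply/cfun_inP => u _.
(* The projection formula: inducing a restriction multiplies the class function by the permutation
   character. *)
rewrite -res_superchar // -['Res[_] _]mul1r cfIndM ?subsetT //.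
rewrite cfunE (ind_one theta_char) (superchar_arc_prod theta_char) // sum_cfunE.
set x := umx u - 1%:M.
under eq_bigr => lam _ do
  rewrite cfunE (superchar_arc_prod theta_char) ?(valP lam) //.
rewrite -/x (sum_val _ (fun M : 'M[F]_n.+1 =>
  star (extmx 0 mu) ord0 ord_max M * arc_prod theta x M)).
rewrite mulrC -[X in _ * X]/(arcs_into theta x (ord0 : 'I_n.+1) ord_max)
  -(star_arc_prod theta_char _ lsp_ext) //; last first.
  by rewrite -unitriangularE umxP.
(* The sum may run over all arrays, because [star] has coefficient 0 at those that are not labeled
   set partitions. *)
rewrite [RHS]big_mkcond; apply: eq_bigr => M _; case: ifP => // /negbT nlsp.
suff /eqP-> : star (extmx 0 mu) ord0 ord_max M == 0 by rewrite mul0r.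
by apply: contraR nlsp; apply: star_lsp.
Qed.
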